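(* Let $p$ be an odd prime and let $A,B\in\mathbb Z$ with $p\nmid AB\Delta$, where $\Delta=A^2-4B$. (i) If $p\equiv1\pmod 4$, then $\sum_{k=0}^{p-1}\frac{u_k(A,B)}{(16A)^k}\binom{2k}k^2\equiv0\pmod{p^2}$. If $p\equiv3\pmod 4$, then $\sum_{k=0}^{p-1}\frac{v_k(A,B)}{(16A)^k}\binom{2k}k^2\equiv0\pmod{p^2}$. (ii) Suppose that $\left(\frac{\Delta}p\right)=1$. If $\left(\frac{-B}p\right)=1$, then $\sum_{k=0}^{p-1}\frac{A^ku_k(A,B)}{(16B)^k}\binom{2k}k^2\equiv0\pmod p$. If $\left(\frac{-B}p\right)=-1$, then $\sum_{k=0}^{p-1}\frac{A^kv_k(A,B)}{(16B)^k}\binom{2k}k^2\equiv0\pmod p$.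
   Context: For $A,B\in\mathbb Z$ the Lucas sequences are defined by $u_0=0$, $u_1=1$, $u_{n+1}=Au_n-Bu_{n-1}$ and $v_0=2$, $v_1=A$, $v_{n+1}=Av_n-Bv_{n-1}$ ($n\ge1$); we write $u_n(A,B)$, $v_n(A,B)$. $\left(\frac{\cdot}{p}\right)$ is the Legendre symbol. Congruences between rationals with denominators prime to $p$ are understood in the ring of such rationals. *)

(* Defs.v *)
From mathcomp Require Import all_boot all_order all_algebra.

Set Implicit Arguments.
Unset Strict Implicit.
Unset Printing Implicit Defensive.

Import Order.TTheory GRing.Theory Num.Theory.
Local Open Scope ring_scope.

Fixpoint lucas_u (A B : int) (n : nat) : int :=
  match n with
  | 0 => 0
  | S m => match m with
           | 0 => 1
           | S l => A * lucas_u A B m - B * lucas_u A B l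
           end
  end.

Fixpoint lucas_v (A B : int) (n : nat) : int :=
  match n with
  | 0 => 2
  | S m => match m with
           | 0 => A
           | S l => A * lucas_v A B m - B * lucas_v A B l
           end
  end.

(* Only meaningful when p is an odd prime. *)
Definition legendre (a : int) (p : nat) : int :=
  if (p %| a)%Z then 0
  else if [exists x : 'I_p, ((x%:Z ^+ 2 == a %[mod p])%Z)] then 1
  else -1.

Definition p_integral (p : nat) (x : rat) : bool := coprimez p (denq x).

(* x = y (mod m) in the localization of the integers at the prime p. *)
Definition congr_p_integral (p : nat) (m : nat) (x y : rat) : Prop :=
  [/\ p_integral p x, p_integral p y
    & exists2 z : rat, p_integral p z & x - y = m%:R * z].

(* Main.v *)
(* Put n = (p - 1)/2. Modulo p^2, the sum of C(2k,k)^2 (x/16)^k over k < p is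
   L(x) = P_n(1 - 2x), with P_n the Legendre polynomial, so the parity of P_n
   gives L(1 - x) = (-1)^n L(x). Let a, b be the roots of t^2 - A t + B.

   For (i), a/A + b/A = 1, so L(a/A) = (-1)^n L(b/A), and the sums for u and v
   are (L(a/A) - L(b/A))/(a - b) and L(a/A) + L(b/A).

   For (ii), a and b lie in F_p and the arguments are Aa/B = 1 + a/b and
   Ab/B = 1 + b/a. In F_p, L(x) is also the sum of C(n,k)^2 x^k, which is
   palindromic, so L(-b/a) = (-b/a)^n L(-a/b), and (-b/a)^n = (-B)^n is the
   Legendre symbol of -ab = -B. *)
Require Import Defs.
From mathcomp Require Import all_boot all_order all_algebra.
From mathcomp Require Import all_field zify ring.

Set Implicit Arguments.
Unset Strict Implicit.
Unset Printing Implicit Defensive.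

Import Order.TTheory GRing.Theory Num.Theory.
Local Open Scope ring_scope.

(** * Shifted Legendre polynomials and their reflection *)

Lemma bin_trinomial n k i : (k + i <= n)%N ->
  ('C(n, k + i) * 'C(k + i, k) = 'C(n, k) * 'C(n - k, i))%N.
Proof.
move=> le_kin; have le_kn : (k <= n)%N by lia.
have e1 := bin_fact le_kin; have e2 := bin_fact (leq_addr i k).
have e3 := bin_fact le_kn.
have le_ink : (i <= n - k)%N by lia.
have e4 := bin_fact le_ink.
rewrite addKn in e2; rewrite -subnDA in e4.
have pos : (0 < k`! * i`! * (n - (k + i))`!)%N by rewrite !muln_gt0 !fact_gt0.
apply/eqP; rewrite -(eqn_pmul2r pos); apply/eqP.
transitivity (n`!)%N; first by rewrite -e1 -e2; ring.
by rewrite -e3 -e4; ring.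
Qed.

Section ShiftedLegendre.

Variable R : comPzRingType.
Implicit Types (n : nat) (x y : R).

(* [shifted_legendre n x] is P_n(1 - 2x), for the Legendre polynomial P_n. *)
Definition shifted_legendre n x : R :=
  \sum_(k < n.+1) ('C(n, k) * 'C(n + k, k))%:R * (- x) ^+ k.

Lemma bin_exprDn n k y : (k <= n)%N ->
  'C(n, k)%:R * (y ^+ k * (1 + y) ^+ (n - k)) =
  \sum_(j < n.+1) ('C(n, j) * 'C(j, k))%:R * y ^+ j.
Proof.
move=> le_kn.
rewrite -(big_mkord xpredT (fun j => ('C(n, j) * 'C(j, k))%:R * y ^+ j)).
rewrite (big_cat_nat _ (n := k)) //=; last by lia.
rewrite big_nat big1 ?add0r; last first.
  by move=> j /andP[_ lt_jk]; rewrite (bin_small lt_jk) muln0 mul0r.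
rewrite -[X in \sum_(X <= _ < _) _]add0n big_addn subSn // big_mkord.
rewrite exprDn !mulr_sumr.
apply: eq_bigr => -[i /= lt_i] _.
rewrite (addnC i) bin_trinomial; last by lia.
by rewrite expr1n mul1r natrM exprD -[_ *+ _]mulr_natr; ring.
Qed.

(** This form makes the reflection visible: [x -> 1 - x] exchanges the two powers up to sign.
    Expanding each term by [bin_exprDn] at [y = - x], the coefficient of [(- x) ^+ j] is [C(n,j)]
    times the sum of [C(n,k) C(j,k)], which is [C(n+j,j)] by Vandermonde. *)
Lemma shifted_legendreE n x :
  shifted_legendre n x =
  \sum_(k < n.+1) ('C(n, k) ^ 2)%:R * ((- x) ^+ k * (1 - x) ^+ (n - k)).
Proof.
transitivity (\sum_(k < n.+1) \sum_(j < n.+1)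
    ('C(n, k) * ('C(n, j) * 'C(j, k)))%:R * (- x) ^+ j); last first.
  apply: eq_bigr => -[k /= lt_k] _.
  rewrite -mulnn natrM -mulrA bin_exprDn; last by lia.
  by rewrite mulr_sumr; apply: eq_bigr => j _; rewrite natrM mulrA.
rewrite exchange_big; apply: eq_bigr => -[j /= lt_j] _.
rewrite -mulr_suml -natr_sum; congr (_%:R * _).
transitivity ('C(n, j) * \sum_(k < n.+1) 'C(j, k) * 'C(n, n - k))%N.
  by rewrite binomial.Vandermonde -(bin_sub (leq_addl j n)) addnK addnC.
rewrite big_distrr /=; apply: eq_bigr => -[k /= lt_k] _.
by rewrite bin_sub //; lia.
Qed.

Lemma shifted_legendre_sym n x :
  shifted_legendre n (1 - x) = (-1) ^+ n * shifted_legendre n x.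
Proof.
rewrite !shifted_legendreE (reindex_inj rev_ord_inj) /= mulr_sumr.
apply: eq_bigr => -[k /= lt_k] _; rewrite !subSS bin_sub; last by lia.
have -> : (n - (n - k) = k)%N by lia.
rewrite subKr (exprNn (1 - x)) (exprNn x).
have -> : (-1) ^+ n = (-1) ^+ (n - k) * (-1) ^+ k :> R by rewrite -exprD subnK.
set C := _%:R; set a := (-1) ^+ (n - k); set b := (1 - x) ^+ (n - k).
set s := (-1) ^+ k.
transitivity (s * s * (C * (a * b * x ^+ k))); last by ring.
by rewrite -expr2 sqrr_sign mul1r.
Qed.

Lemma shifted_legendre_sum n m x : (n < m)%N ->
  \sum_(0 <= k < m) ('C(n, k) * 'C(n + k, k))%:R * (- x) ^+ k =
  shifted_legendre n x.
Proof.
move=> lt_nm; rewrite (big_cat_nat _ (n := n.+1)) //= big_mkord.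
rewrite [X in _ + X]big_nat [X in _ + X]big1 ?addr0 // => k /andP[lt_nk _].
by rewrite bin_small // mul0n mul0r.
Qed.

End ShiftedLegendre.

(** * Squares of central binomial coefficients modulo [p ^ 2] *)

(* Both sides are products over 1 <= j <= k, up to the factor 4^k / k!^2: of
   (2j - 1)^2 on the left and of (2j - 1)^2 - p^2 on the right. *)
Lemma central_bin_congr (p n k : nat) :
  prime p -> p = n.*2.+1 -> (k < p)%N ->
  ((p ^ 2)%N %| ('C(2 * k, k) ^ 2)%N%:Z
                - (-16) ^+ k * ('C(n, k) * 'C(n + k, k))%N%:Z)%Z.
Proof.
move=> p_pr def_p; elim: k => [|k IHk] lt_kp.
  by rewrite muln0 addn0 !bin0 expr0 mul1r subrr dvdz0.
have {}IHk := IHk (ltnW lt_kp).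
(* As [k + 1 < p], multiplying by [(k + 1)^2] loses nothing modulo [p ^ 2] and makes the recurrences
   of both sides free of division. *)
have co : coprimez (p ^ 2)%N (k.+1%:Z ^+ 2).
  rewrite coprimezE abszX /= coprimeXl ?coprimeXr // prime_coprime //.
  by rewrite gtnNdvd.
rewrite -(Gauss_dvdzr _ co) mulrBr.
have e1 : k.+1%:Z ^+ 2 * ('C(2 * k.+1, k.+1) ^ 2)%N%:Z
    = 4 * (2 * k%:Z + 1) ^+ 2 * ('C(2 * k, k) ^ 2)%N%:Z.
  have h : (k.+1 * 'C(2 * k.+1, k.+1) = 2 * (2 * k + 1) * 'C(2 * k, k))%N.
    have a := mul_bin_diag (2 * k.+1) k; have b := mul_bin_down (2 * k.+1).-1 k.
    have c : (2 * k.+1).-1.-1 = (2 * k)%N by lia.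
    have d : ((2 * k.+1).-1 - k)%N = k.+1 by lia.
    by rewrite c d in b; nia.
  have h' : (k.+1%:Z * 'C(2 * k.+1, k.+1)%:Z
     = 2 * (2 * k%:Z + 1) * 'C(2 * k, k)%:Z) by rewrite -!PoszM h; lia.
  by rewrite -!mulnn !PoszM -expr2 -exprMn h'; ring.
have e2 : k.+1%:Z ^+ 2 * ('C(n, k.+1) * 'C(n + k.+1, k.+1))%N%:Z
    = (n%:Z - k%:Z) * (n%:Z + k%:Z + 1) * ('C(n, k) * 'C(n + k, k))%N%:Z.
  have a : (k.+1%:Z * 'C(n, k.+1)%:Z = (n%:Z - k%:Z) * 'C(n, k)%:Z).
    have b := mul_bin_left n k.
    have [le_kn|lt_nk] := leqP k n; last by rewrite !bin_small; lia.
    by rewrite subzn // -!PoszM b.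
  have b : (k.+1%:Z * 'C(n + k.+1, k.+1)%:Z
            = (n%:Z + k%:Z + 1) * 'C(n + k, k)%:Z).
    by have := mul_bin_diag (n + k.+1) k; rewrite addnS /=; lia.
  by rewrite !PoszM expr2 mulrACA a b; ring.
rewrite e1 [(-16) ^+ _]exprS (mulrCA (k.+1%:Z ^+ 2)) e2.
set X := (_ ^ 2)%N%:Z in IHk *; set Y := ('C(n, k) * _)%N%:Z in IHk *.
(* The key identity is [4(n - k)(n + k + 1) = (2n + 1)^2 - (2k + 1)^2], with [2n + 1 = p]. *)
have -> : 4 * (2 * k%:Z + 1) ^+ 2 * X - -16 * (-16) ^+ k
             * ((n%:Z - k%:Z) * (n%:Z + k%:Z + 1) * Y)
   = 4 * (2 * k%:Z + 1) ^+ 2 * (X - (-16) ^+ k * Y)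
     + (p ^ 2)%N%:Z * (4 * (-16) ^+ k * Y).
  have -> : (p ^ 2)%N%:Z = (2 * n%:Z + 1) ^+ 2 by rewrite def_p; lia.
  by ring.
by rewrite rpredD //; [exact: dvdz_mull | exact: dvdz_mulr].
Qed.

(** * Palindromic form in characteristic [p] *)

Section FieldOfCharP.

Variables (F : fieldType) (p n : nat).
Hypotheses (charFp : p \in [pchar F]) (def_p : p = n.*2.+1).

(** The left side is the binomial coefficient of [-n - 1] over [k], and [-n - 1 = n] in [F] because
    [2n + 1 = p]. The bound on [k] keeps the denominators [1, ..., k] invertible. *)
Lemma bin_half_pchar k : (k < p)%N ->
  'C(n + k, k)%:R * (-1) ^+ k = 'C(n, k)%:R :> F.
Proof.
elim: k => [|k IHk] lt_kp; first by rewrite !bin0 mulr1.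
have k1_neq0 : k.+1%:R != 0 :> F by rewrite -(dvdn_pcharf charFp) gtnNdvd.
apply: (mulfI k1_neq0); rewrite mulrA -!natrM (mul_bin_left n k).
have -> : (k.+1 * 'C(n + k.+1, k.+1) = (n + k).+1 * 'C(n + k, k))%N.
  by rewrite -mul_bin_diag addnS.
rewrite natrM exprS mulrACA (IHk (ltnW lt_kp)) [RHS]natrM.
have [le_kn|lt_nk] := leqP k n; last by rewrite bin_small // !mulr0.
congr (_ * _); rewrite mulrN1; apply/eqP; rewrite eq_sym -addr_eq0 -natrD.
by rewrite (_ : _ + _ = p)%N ?(pcharf0 charFp) //; lia.
Qed.

Lemma shifted_legendre_squares (x : F) :
  shifted_legendre n x = \sum_(k < n.+1) ('C(n, k) ^ 2)%:R * x ^+ k.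
Proof.
apply: eq_bigr => -[k /= lt_k] _; rewrite -mulnn !natrM (exprNn x).
have lt_kp : (k < p)%N by lia.
by rewrite -{3}(bin_half_pchar lt_kp) !mulrA.
Qed.

Lemma shifted_legendre_inv (x y : F) : x * y = 1 ->
  shifted_legendre n y = y ^+ n * shifted_legendre n x.
Proof.
move=> xy1; rewrite !shifted_legendre_squares (reindex_inj rev_ord_inj) /=.
rewrite mulr_sumr; apply: eq_bigr => -[k /= lt_k] _.
rewrite subSS bin_sub //; have -> : y ^+ n = y ^+ (n - k) * y ^+ k.
  by rewrite -exprD subnK.
have xyk : y ^+ k * x ^+ k = 1 by rewrite -exprMn mulrC xy1 expr1n.
set a := _%:R; set b := y ^+ (n - k).
transitivity (y ^+ k * x ^+ k * (a * b)); first by rewrite xyk mul1r.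
by ring.
Qed.

End FieldOfCharP.

(** * Euler's criterion and the Legendre symbol *)

Lemma fermat_half (p n : nat) (x : 'F_p) :
  prime p -> p = n.*2.+1 -> x != 0 -> x ^+ n.*2 = 1.
Proof.
move=> p_pr def_p x_neq0; apply: (mulfI x_neq0).
rewrite -exprS mulr1 -[RHS]expf_card (card_Fp p_pr).
by congr (x ^+ _).
Qed.

(* If a nonsquare satisfied a^n = 1, it would be, with the n squares, one root
   too many for X^n - 1. *)
Lemma euler_nonsquare (p n : nat) (a : 'F_p) :
  prime p -> p = n.*2.+1 -> a != 0 -> (forall x, x ^+ 2 != a) -> a ^+ n = -1.
Proof.
move=> p_pr def_p a_neq0 nsq.
have fermat x := fermat_half (x := x) p_pr def_p.
have : (a ^+ n) ^+ 2 == 1 by rewrite -exprM muln2 fermat.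
rewrite sqrf_eq1 => /orP[/eqP an1|/eqP//].
have charp := pchar_Fp p_pr.
pose rs := a :: [seq (i.+1%:R : 'F_p) ^+ 2 | i <- iota 0 n].
have P_neq0 : 'X^n - 1 != 0 :> {poly 'F_p}.
  by rewrite -size_poly_gt0 size_XnsubC //; have := prime_gt1 p_pr; lia.
have : (size rs < size ('X^n - 1 : {poly 'F_p})%R)%N.
  apply: max_poly_roots => //.
    rewrite /rs /= rootE !hornerE an1 subrr eqxx /=.
    apply/allP => y /mapP[i]; rewrite mem_iota => /andP[_ lt_in] -> {y}.
    rewrite rootE !hornerE -exprM mul2n fermat ?subrr //.
    by rewrite -(dvdn_pcharf charp) gtnNdvd //; lia.
  rewrite /rs /=; apply/andP; split.
    by apply/mapP => -[i _ aE]; have := nsq i.+1%:R; rewrite aE eqxx.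
  have natr_inj i j : (i <= j < n)%N -> i.+1%:R = j.+1%:R :> 'F_p -> i = j.
    move=> /andP[le_ij lt_jn] /esym/eqP; rewrite -subr_eq0 -natrB //.
    rewrite -(dvdn_pcharf charp) subSS => p_dvd.
    have [|ij_gt0] := posnP (j - i); first by lia.
    by rewrite gtnNdvd // in p_dvd; lia.
  rewrite map_inj_in_uniq ?iota_uniq // => i j.
  rewrite !mem_iota => /andP[_ lt_in] /andP[_ lt_jn] /eqP.
  (* The squares of [1, ..., n] are distinct: opposite values are excluded because a sum of two of
     these numbers lies strictly between 0 and [p]. *)
  rewrite eqf_sqr => /orP[/eqP ij|]; last first.
    by rewrite -addr_eq0 -natrD -(dvdn_pcharf charp) gtnNdvd //; lia.
  have [le_ij|/ltnW le_ji] := leqP i j; first by apply: natr_inj ij; lia.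
  by apply/esym/natr_inj; [lia | exact/esym].
rewrite /rs /= size_map size_iota size_XnsubC ?ltnn //.
by have := prime_gt1 p_pr; lia.
Qed.

Lemma legendre_eq1 (p : nat) (a : int) : prime p ->
  legendre a p = 1 -> ~~ (p %| a)%Z /\ exists x : 'F_p, x ^+ 2 = a%:~R.
Proof.
move=> p_pr; rewrite /legendre; case: ifP => [//|_].
case: ifP => [/existsP[x x2a] _|//]; split=> //; exists x%:R; apply/eqP.
rewrite -subr_eq0 pmulrn -rmorphXn -rmorphB.
by rewrite -(dvdz_pcharf (pchar_Fp p_pr)) -eqz_mod_dvd.
Qed.

Lemma legendre_eqN1 (p : nat) (a : int) : prime p ->
  legendre a p = -1 -> ~~ (p %| a)%Z /\ forall x : 'F_p, x ^+ 2 != a%:~R.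
Proof.
move=> p_pr; rewrite /legendre; case: ifP => [//|_].
case: ifPn => [//|nsq _]; split=> // x; apply: contra nsq => x2a.
(* The bound built into ['F_p] is only equal to [p] through [Fp_cast], which needs [p] prime. *)
have lt_xp : (x < p)%N by rewrite -[ltnRHS](Fp_cast p_pr).
apply/existsP; exists (Ordinal lt_xp).
rewrite eqz_mod_dvd (dvdz_pcharf (pchar_Fp p_pr)) rmorphB rmorphXn /=.
by rewrite -pmulrn natr_Zp subr_eq0.
Qed.

(** * Localization at [p] and clearing of denominators *)

(** The reduced denominator divides [D], by cross-multiplication and coprimality with the
    numerator. *)
Lemma p_integral_frac (p : nat) (m D : int) : prime p -> ~~ (p %| D)%Z ->
  p_integral p (m%:~R / D%:~R).
Proof.
move=> p_pr p_ndvdD; rewrite /p_integral; set x := _ / _.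
have D_neq0 : D%:~R != 0 :> rat.
  by rewrite intr_eq0; apply: contraNneq p_ndvdD => ->; exact: dvdz0.
have cross : numq x * D = m * denq x.
  have : (numq x * D)%:~R = (m * denq x)%:~R :> rat.
    by rewrite !rmorphM /= numqE mulrAC divfK.
  exact: intr_inj.
have dvd_den : (denq x %| D)%Z.
  rewrite -(@Gauss_dvdzr _ (numq x)); first by rewrite cross dvdz_mull.
  by rewrite coprimez_sym coprimezE coprime_num_den.
rewrite coprimezE prime_coprime //; apply: contra p_ndvdD => p_dvd.
exact: dvdz_trans dvd_den.
Qed.

(** Multiplying by [M ^+ p], a unit at [p], reduces the congruence between rationals to a
    divisibility between integers. *)
Lemma congr_cleared_sum (p e : nat) (M : int) (w : nat -> int)
    (c : nat -> nat) :
  prime p -> ~~ (p %| M)%Z ->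
  ((p ^ e)%N %| \sum_(0 <= k < p) w k * (c k)%:Z * M ^+ (p - k))%Z ->
  congr_p_integral p (p ^ e)
    (\sum_(0 <= k < p) (w k)%:~R / M%:~R ^+ k * (c k)%:R) 0.
Proof.
move=> p_pr p_ndvdM; set N := (X in (_ %| X)%Z) => /dvdzP[q def_N].
have p_ndvdMp : ~~ (p %| M ^+ p)%Z.
  by rewrite dvdzE abszX Euclid_dvdX // negb_and -dvdzE p_ndvdM.
have M_neq0 : M%:~R != 0 :> rat.
  by rewrite intr_eq0; apply: contraNneq p_ndvdM => ->; exact: dvdz0.
set S := (X in congr_p_integral _ _ X).
have SE : S = N%:~R / (M ^+ p)%:~R.
  rewrite rmorph_sum mulr_suml; apply: eq_big_nat => k /andP[_ lt_kp].
  rewrite !(rmorphM, rmorphXn) /= -pmulrn.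
  rewrite -{2}(subnK (ltnW lt_kp)) exprD.
  have := expf_neq0 (p - k) M_neq0; have := expf_neq0 k M_neq0.
  move: (_ ^+ k) (_ ^+ (p - k)) => u v u0 v0; field.
  by rewrite u0.
split.
- by rewrite SE p_integral_frac.
- by rewrite /p_integral -(mulr0z 1) denq_int coprimezE coprimen1.
exists (q%:~R / (M ^+ p)%:~R); first exact: p_integral_frac.
by rewrite subr0 SE def_N rmorphM /= -pmulrn mulrA [_ * q%:~R]mulrC.
Qed.

(** * Binet formulas *)

Section LucasBinet.

Variables (R : comPzRingType) (a b : R) (A B : int).
Hypotheses (sum_ab : A%:~R = a + b) (prod_ab : B%:~R = a * b).

Lemma lucas_uE k : (a - b) * (lucas_u A B k)%:~R = a ^+ k - b ^+ k.
Proof.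
elim/ltn_ind: k => -[|[|k]] IHk /=; rewrite ?mulr0 ?subrr ?mulr1 ?expr1 //.
have /= IH1 := IHk k.+1 (leqnn _); have /= IH0 := IHk k (leqW (leqnn _)).
rewrite -/(lucas_u A B k.+1) in IH1 *.
rewrite rmorphB !rmorphM /= sum_ab prod_ab.
transitivity ((a + b) * ((a - b) * (lucas_u A B k.+1)%:~R)
              - a * b * ((a - b) * (lucas_u A B k)%:~R)); first by ring.
by rewrite IH1 IH0 !exprS; ring.
Qed.

Lemma lucas_vE k : (lucas_v A B k)%:~R = a ^+ k + b ^+ k.
Proof.
elim/ltn_ind: k => -[|[|k]] IHk /=; rewrite ?expr1 //.
have /= IH1 := IHk k.+1 (leqnn _); have /= IH0 := IHk k (leqW (leqnn _)).
rewrite -/(lucas_v A B k.+1) in IH1 *.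
by rewrite rmorphB !rmorphM /= sum_ab prod_ab IH1 IH0 !exprS; ring.
Qed.

End LucasBinet.

(** The square root [x] of the discriminant is an argument because it comes from [sqrtC] in [algC]
    and from the Legendre symbol in ['F_p]. *)
Lemma quadratic_roots (F : fieldType) (A B : int) (x : F) :
  2 != 0 :> F -> x ^+ 2 = (A ^+ 2 - 4 * B)%:~R -> x != 0 ->
  exists a b : F, [/\ A%:~R = a + b, B%:~R = a * b & a - b != 0].
Proof.
move=> F2 x2 x_neq0; exists ((A%:~R + x) / 2), ((A%:~R - x) / 2).
have F4 : 4 != 0 :> F by rewrite (natrM _ 2 2) mulf_neq0.
split; first by field.
  have -> : (A%:~R + x) / 2 * ((A%:~R - x) / 2)
           = (A%:~R ^+ 2 - x ^+ 2) / 4 :> F by field; rewrite F4.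
  by rewrite x2 rmorphB rmorphXn rmorphM /=; field.
by have -> : (A%:~R + x) / 2 - (A%:~R - x) / 2 = x by field.
Qed.

(* Covers u and v at once: for u_k take delta = a - b and s = -1, for v_k take
   delta = s = 1. *)
Lemma binet_sum (F : fieldType) (m : nat) (M c : int) (w d : nat -> int)
    (a b delta s : F) :
  M%:~R != 0 :> F ->
  (forall k, delta * (w k)%:~R = a ^+ k + s * b ^+ k) ->
  delta * (\sum_(0 <= k < m) c ^+ k * w k * d k * M ^+ (m - k))%:~R =
  M%:~R ^+ m * (\sum_(0 <= k < m) (d k)%:~R * (c%:~R * a / M%:~R) ^+ k
    + s * \sum_(0 <= k < m) (d k)%:~R * (c%:~R * b / M%:~R) ^+ k).
Proof.
move=> M_neq0 wE; rewrite rmorph_sum !mulr_sumr -big_split mulr_sumr /=.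
apply: eq_big_nat => k /andP[_ lt_km].
rewrite !rmorphM /= !rmorphXn /= !exprMn !exprVn.
rewrite -{2}(subnK (ltnW lt_km)) exprD.
transitivity (c%:~R ^+ k * (delta * (w k)%:~R) * (d k)%:~R * M%:~R ^+ (m - k)).
  by ring.
rewrite wE; have := expf_neq0 k M_neq0.
move: (M%:~R ^+ k) (M%:~R ^+ (m - k)) => u v u0; field.
exact: u0.
Qed.

(** * The two congruences, for [u] and [v] together *)

Lemma ndvdz_mul16 (p : nat) (A : int) :
  odd p -> ~~ (p %| A)%Z -> ~~ (p %| (16 * A))%Z.
Proof.
move=> p_odd; rewrite Gauss_dvdzr // coprimezE.
by rewrite -[`|_|%N in X in coprime _ X]/(2 ^ 4)%N coprimeXr // coprimen2.
Qed.

Lemma sum_scaled_shifted_legendre (F : fieldType) (p n : nat) (x : F) :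
  (n < p)%N ->
  \sum_(0 <= k < p) ((-16) ^+ k * ('C(n, k) * 'C(n + k, k))%N%:Z)%:~R * x ^+ k
  = shifted_legendre n (16 * x).
Proof.
move=> lt_np; rewrite -(shifted_legendre_sum (16 * x) lt_np).
apply: eq_bigr => k _.
rewrite rmorphM rmorphXn /= -pmulrn mulrAC -exprMn mulrC.
by rewrite rmorphN /= mulNr.
Qed.

Lemma congr_lucas_p2 (p n : nat) (A : int) (w : nat -> int)
    (a b delta s : algC) :
  prime p -> p = n.*2.+1 -> ~~ (p %| A)%Z -> A%:~R = a + b -> delta != 0 ->
  (forall k, delta * (w k)%:~R = a ^+ k + s * b ^+ k) -> s = - (-1) ^+ n ->
  congr_p_integral p (p ^ 2)
    (\sum_(0 <= k < p) (w k)%:~R / (16 * A%:~R) ^+ k * ('C(2 * k, k) ^ 2)%:R) 0.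
Proof.
move=> p_pr def_p p_ndvdA sum_ab delta0 wE s_sign.
have -> : 16 * A%:~R = (16 * A)%:~R :> rat by rewrite rmorphM.
have p_ndvdM : ~~ (p %| (16 * A))%Z.
  by apply: ndvdz_mul16 => //; rewrite def_p /= odd_double.
apply: congr_cleared_sum => //; set M := 16 * A.
pose d k : int := (-16) ^+ k * ('C(n, k) * 'C(n + k, k))%N%:Z.
have A_neq0 : A%:~R != 0 :> algC.
  by rewrite intr_eq0; apply: contraNneq p_ndvdA => ->; exact: dvdz0.
have M_neq0 : M%:~R != 0 :> algC.
  by rewrite rmorphM mulf_neq0 // intr_eq0.
(* After [d] replaces the squared central binomials, the sum is exactly 0 in the integers. This can
   be checked with complex roots, so no roots modulo [p ^ 2] are required; the congruence is then
   applied term by term. *)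
have zero : \sum_(0 <= k < p) 1 ^+ k * w k * d k * M ^+ (p - k) = 0.
  apply: (@intr_inj algC); apply: (mulfI delta0).
  rewrite (binet_sum _ _ d M_neq0 wE) mulr0.
  have lt_np : (n < p)%N by lia.
  rewrite !sum_scaled_shifted_legendre //.
  have xE (c : algC) : 16 * (1%:~R * c / M%:~R) = c / A%:~R.
    by rewrite /M rmorphM /= -pmulrn; field; rewrite A_neq0.
  rewrite !xE; have -> : b / A%:~R = 1 - a / A%:~R.
    by rewrite sum_ab in A_neq0 *; field.
  rewrite shifted_legendre_sym s_sign mulrA mulNr -expr2 sqrr_sign mulN1r.
  by rewrite subrr mulr0.
rewrite -[X in (_ %| X)%Z]subr0 -[X in _ - X]zero -sumrB big_nat.
apply: rpred_sum => k /andP[_ lt_kp].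
rewrite expr1n mul1r -mulrBl -mulrBr dvdz_mulr // dvdz_mull //.
exact: central_bin_congr.
Qed.

(** The roots must lie in ['F_p] here, since the palindromic form holds only in characteristic [p].
    Reflection and inversion turn the bracket of [binet_sum] into a multiple of [1 - (- B)^(2n)],
    which is 0 by Fermat. *)
Lemma congr_lucas_p (p n : nat) (A B : int) (w : nat -> int)
    (a b delta s : 'F_p) :
  prime p -> p = n.*2.+1 -> ~~ (p %| B)%Z ->
  A%:~R = a + b -> B%:~R = a * b -> delta != 0 ->
  (forall k, delta * (w k)%:~R = a ^+ k + s * b ^+ k) ->
  s = - (- B%:~R) ^+ n ->
  congr_p_integral p p
    (\sum_(0 <= k < p)
       (A ^+ k * w k)%:~R / (16 * B%:~R) ^+ k * ('C(2 * k, k) ^ 2)%:R) 0.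
Proof.
move=> p_pr def_p p_ndvdB sum_ab prod_ab delta0 wE s_sign.
have charp := pchar_Fp p_pr.
have -> : 16 * B%:~R = (16 * B)%:~R :> rat by rewrite rmorphM.
have p_ndvdM : ~~ (p %| (16 * B))%Z.
  by apply: ndvdz_mul16 => //; rewrite def_p /= odd_double.
rewrite -[X in congr_p_integral _ X]expn1.
apply: (congr_cleared_sum (w := fun k => A ^+ k * w k)) => //; set M := 16 * B.
rewrite expn1 (dvdz_pcharf charp).
have M_neq0 : M%:~R != 0 :> 'F_p by rewrite -(dvdz_pcharf charp).
pose d k : int := ('C(2 * k, k) ^ 2)%N%:Z.
rewrite -(mulrI_eq0 _ (mulfI delta0)) (binet_sum _ _ d M_neq0 wE).
have dE (x : 'F_p) : \sum_(0 <= k < p) (d k)%:~R * x ^+ k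
                     = shifted_legendre n (16 * x).
  have lt_np : (n < p)%N by lia.
  rewrite -(sum_scaled_shifted_legendre x lt_np).
  apply: eq_big_nat => k /andP[_ lt_kp].
  congr (_ * _); apply/eqP.
  rewrite -subr_eq0 -rmorphB -(dvdz_pcharf charp).
  apply: dvdz_trans (central_bin_congr p_pr def_p lt_kp).
  by rewrite dvdzE /= dvdn_exp.
rewrite !dE.
have : B%:~R != 0 :> 'F_p by rewrite -(dvdz_pcharf charp).
rewrite prod_ab mulf_eq0 negb_or => /andP[a0 b0].
have F16 : 16 != 0 :> 'F_p.
  by apply: contraNneq M_neq0; rewrite rmorphM /= -pmulrn => ->; rewrite mul0r.
have -> : 16 * (A%:~R * a / M%:~R) = 1 - (- (a / b)).
  rewrite /M rmorphM /= -pmulrn prod_ab sum_ab; field.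
  by rewrite a0 b0 F16.
have -> : 16 * (A%:~R * b / M%:~R) = 1 - (- (b / a)).
  rewrite /M rmorphM /= -pmulrn prod_ab sum_ab; field.
  by rewrite a0 b0 F16.
rewrite !shifted_legendre_sym.
have inv_ab : - (a / b) * - (b / a) = 1 by field; rewrite a0 b0.
rewrite (shifted_legendre_inv charp def_p inv_ab).
(* The two bases differ by the factor [a ^+ 2], whose [n]-th power is 1. *)
have sgnE : (- (b / a)) ^+ n = (- B%:~R) ^+ n.
  have -> : - (b / a) = - B%:~R / a ^+ 2 by rewrite prod_ab; field.
  by rewrite exprMn exprVn -exprM mul2n (fermat_half p_pr def_p a0) invr1 mulr1.
have : (- B%:~R : 'F_p) ^+ n * (- B%:~R) ^+ n = 1.
  rewrite -exprD addnn (fermat_half p_pr def_p) // oppr_eq0.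
  by rewrite -(dvdz_pcharf charp).
rewrite sgnE s_sign.
set u := (- B%:~R) ^+ n; set v := (-1) ^+ n.
set L := shifted_legendre _ _ => uu1.
have -> : v * L + - u * (v * (u * L)) = v * L * (1 - u * u) by ring.
by rewrite uu1 subrr !mulr0.
Qed.

Theorem theorem1p2 (p : nat) (A B : int)
    (p_prime : prime p) (p_odd : odd p)
    (p_ndvd : ~~ (p %| A * B * (A ^+ 2 - 4 * B))%Z) :
  ((p = 1 %[mod 4] ->
      congr_p_integral p (p ^ 2)
        (\sum_(0 <= k < p)
           (lucas_u A B k)%:~R / (16 * A%:~R) ^+ k * ('C(2 * k, k) ^ 2)%:R) 0) /\
   (p = 3 %[mod 4] ->
      congr_p_integral p (p ^ 2)
        (\sum_(0 <= k < p)
           (lucas_v A B k)%:~R / (16 * A%:~R) ^+ k * ('C(2 * k, k) ^ 2)%:R) 0))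
  /\
  (legendre (A ^+ 2 - 4 * B) p = 1 ->
   (legendre (- B) p = 1 ->
      congr_p_integral p p
        (\sum_(0 <= k < p)
           (A ^+ k * lucas_u A B k)%:~R / (16 * B%:~R) ^+ k
           * ('C(2 * k, k) ^ 2)%:R) 0) /\
   (legendre (- B) p = -1 ->
      congr_p_integral p p
        (\sum_(0 <= k < p)
           (A ^+ k * lucas_v A B k)%:~R / (16 * B%:~R) ^+ k
           * ('C(2 * k, k) ^ 2)%:R) 0)).
Proof.
have def_p : p = p./2.*2.+1 by rewrite -[LHS]odd_double_half p_odd.
move: p_ndvd; rewrite dvdzE !abszM !Euclid_dvdM // !negb_or -!dvdzE.
move=> /andP[/andP[p_ndvdA p_ndvdB] p_ndvdD].
have uE (R : comPzRingType) (a b : R) :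
    A%:~R = a + b -> B%:~R = a * b ->
    forall k, (a - b) * (lucas_u A B k)%:~R = a ^+ k + -1 * b ^+ k.
  by move=> sum_ab prod_ab k; rewrite (lucas_uE sum_ab prod_ab) mulN1r.
have vE (R : comPzRingType) (a b : R) :
    A%:~R = a + b -> B%:~R = a * b ->
    forall k, 1 * (lucas_v A B k)%:~R = a ^+ k + 1 * b ^+ k.
  by move=> sum_ab prod_ab k; rewrite (lucas_vE sum_ab prod_ab) !mul1r.
split.
  have [||a [b [sum_ab prod_ab ab_neq0]]] :=
    @quadratic_roots algC A B _ _ (sqrtCK _); first by rewrite pnatr_eq0.
    rewrite sqrtC_eq0 intr_eq0; apply: contraNneq p_ndvdD => ->; exact: dvdz0.
  (* Here [n] is [p./2], even or odd as [p] is 1 or 3 modulo 4, so [- (-1) ^+ n] is the sign [s] of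
     [u] or of [v] respectively. *)
  split=> p_mod4.
    apply: (congr_lucas_p2 _ def_p _ sum_ab ab_neq0
              (uE _ _ _ sum_ab prod_ab)) => //.
    by rewrite -signr_odd (_ : odd p./2 = false) //; lia.
  apply: (congr_lucas_p2 _ def_p _ sum_ab (oner_neq0 _)
            (vE _ _ _ sum_ab prod_ab)) => //.
  by rewrite -signr_odd (_ : odd p./2 = true) ?expr1 ?opprK //; lia.
move=> /legendre_eq1[]// _ [x x2].
have charp := pchar_Fp p_prime.
have [||a [b [sum_ab prod_ab ab_neq0]]] := quadratic_roots _ x2.
- by rewrite -(dvdn_pcharf charp) gtnNdvd //; have := prime_gt1 p_prime; lia.
- apply: contraNneq p_ndvdD => x0.
  by rewrite (dvdz_pcharf charp) -x2 x0 expr0n.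
have B_neq0 : - B%:~R != 0 :> 'F_p.
  by rewrite oppr_eq0 -(dvdz_pcharf charp).
(* Now [(- B) ^+ n] is 1 by Fermat when [- B] is a square and -1 by Euler's criterion otherwise; its
   opposite is again the sign of [u] or of [v]. *)
split=> legB.
  apply: (congr_lucas_p _ def_p _ sum_ab prod_ab ab_neq0
            (uE _ _ _ sum_ab prod_ab)) => //.
  have [_ [y]] := legendre_eq1 p_prime legB; rewrite rmorphN /= => y2.
  rewrite -y2 -exprM mul2n (fermat_half p_prime def_p) //.
  by apply: contraNneq B_neq0 => y0; rewrite -y2 y0 expr0n.
apply: (congr_lucas_p _ def_p _ sum_ab prod_ab (oner_neq0 _)
          (vE _ _ _ sum_ab prod_ab)) => //.
have [_ nsq] := legendre_eqN1 p_prime legB.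
rewrite (euler_nonsquare p_prime def_p B_neq0) ?opprK // => y.
by have := nsq y; rewrite rmorphN.
Qed.
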